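(* Let $0 \le \varepsilon < \tfrac12$ be fixed. The randomized (and the deterministic) two-party communication complexity of the following task is $\Omega(n^2)$: given a marriage market $(W,M,\succ_W,\succ_M)$ with full preference lists and $|W|=|M|=n$, where Alice holds the women's profile $\succ_W$ and Bob holds the men's profile $\succ_M$, output a perfect marriage between $W$ and $M$ that is $(1-\varepsilon)$-stable.
   Context: A marriage market with full preference lists consists of disjoint sets $W$ (women) and $M$ (men) with $|W|=|M|=n$, a profile $\succ_W$ giving each woman a total order on $M$, and a profile $\succ_M$ giving each man a total order on $W$. A perfect marriage is a bijection between $W$ and $M$, identified with its set of $n$ married pairs. A pair $(w,m)$ is blocking for a perfect marriage $\mu$ if $w$ prefers $m$ to her spouse in $\mu$ and $m$ prefers $w$ to his spouse in $\mu$; $\mu$ is stable if it has no blocking pair. The divorce distance between perfect marriages $\mu,\mu'$ is $d(\mu,\mu')=n-|\mu\cap\mu'|$, and $d(\mu)=\min_{\mu'} d(\mu,\mu')$ over all stable perfect marriages $\mu'$. $\mu$ is $(1-\varepsilon)$-stable if $d(\mu)\le \varepsilon n$. In two-party communication complexity, the cost of a protocol is the number of bits exchanged in the worst case over inputs; a randomized protocol must give a correct output with probability at least $2/3$ on every input; the complexity of a task is the least cost of a protocol solving it. The bound is asymptotic in $n$. *)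

(* Defs.v *)
From HB Require Import structures.
From mathcomp Require Import all_boot all_order all_algebra all_fingroup.
From Stdlib Require Rdefinitions.
From mathcomp Require Import Rstruct.
Notation R := Rdefinitions.R.
Local Open Scope ring_scope.
Set Implicit Arguments. Unset Strict Implicit. Unset Printing Implicit Defensive.
Import Order.TTheory GRing.Theory Num.Theory.

(* Women and men are both indexed by 'I_n.  A total order on a set of n
   agents is given by a ranking permutation: rank x is the position of x
   (position 0 = most preferred). *)
Definition pref (n : nat) := {perm 'I_n}.
Definition profile (n : nat) := {ffun 'I_n -> pref n}.
(* a perfect marriage: mu w = husband of woman w; (mu^-1) m = wife of m *)
Definition marriage (n : nat) := {perm 'I_n}.

Definition prefers n (P : profile n) (a x y : 'I_n) : bool := (P a x < P a y)%N.

Definition blocking n (PW PM : profile n) (mu : marriage n) (w m : 'I_n) : bool :=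
  prefers PW w m (mu w) && prefers PM m w ((mu^-1)%g m).

Definition stable n (PW PM : profile n) (mu : marriage n) : bool :=
  [forall w, forall m, ~~ blocking PW PM mu w m].

Definition divorce_dist n (mu mu' : marriage n) : nat :=
  (n - #|[set w : 'I_n | mu w == mu' w]|)%N.

(* d(mu) = min over stable marriages mu' of d(mu,mu') (stable marriages always
   exist, so the default value n of the min is never used) *)
Definition dist_to_stable n (PW PM : profile n) (mu : marriage n) : nat :=
  (\big[minn/n]_(mu' : marriage n | stable PW PM mu') divorce_dist mu mu')%N.

Definition almost_stable (eps : R) n (PW PM : profile n) (mu : marriage n) : bool :=
  ((dist_to_stable PW PM mu)%:R <= eps * n%:R)%R.

Inductive protocol (X Y O : Type) : Type :=
| Leaf : O -> protocol X Y O
| AliceSends : (X -> bool) -> protocol X Y O -> protocol X Y O -> protocol X Y O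
| BobSends : (Y -> bool) -> protocol X Y O -> protocol X Y O -> protocol X Y O.

Arguments Leaf {X Y O}.
Arguments AliceSends {X Y O}.
Arguments BobSends {X Y O}.

Fixpoint run X Y O (p : protocol X Y O) (x : X) (y : Y) : O :=
  match p with
  | Leaf o => o
  | AliceSends f p0 p1 => if f x then run p1 x y else run p0 x y
  | BobSends g p0 p1 => if g y then run p1 x y else run p0 x y
  end.

Fixpoint cost X Y O (p : protocol X Y O) : nat :=
  match p with
  | Leaf _ => 0
  | AliceSends _ p0 p1 => ((maxn (cost p0) (cost p1)).+1)%N
  | BobSends _ p0 p1 => ((maxn (cost p0) (cost p1)).+1)%N
  end.

(* A randomized protocol is a finitely supported probability distribution over
   deterministic protocols (the public random string selects the protocol). *)
Definition rprotocol X Y O := seq (R * protocol X Y O).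

Definition is_distribution X Y O (D : rprotocol X Y O) : Prop :=
  all (fun e => 0 <= e.1)%R D /\ (\sum_(e <- D) e.1 = 1)%R.

Definition rcost X Y O (D : rprotocol X Y O) : nat :=
  (\max_(e <- D | (0 < e.1)%R) cost e.2)%N.

Definition success_prob X Y O (D : rprotocol X Y O) (ok : X -> Y -> O -> bool)
  (x : X) (y : Y) : R :=
  (\sum_(e <- D | ok x y (run e.2 x y)) e.1)%R.

(* Main.v *)
(**
Set disjointness on [k^2] bits is embedded in a market with [n] women and [n]
men, where [2k < (1 - 2 eps) n].  Alice's set and Bob's set determine whom the
first [2k] agents like, and the other agents form a chain with a reference
matching.  If the sets are disjoint, every stable marriage keeps the reference
matching on the whole chain; if they meet, the divorce caused by a common
element travels down the chain, and no stable marriage keeps any pair of it.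
As [eps < 1/2], an almost stable marriage tells the two cases apart.

Randomized disjointness on [K] bits costs [Omega(K)] by a corruption bound.
Give each coordinate at random to one of the players, who then flips a fair
coin for it.  In a rectangle of density at least [2^-m], most coordinates stay
almost unbiased for their owner, by AM-GM applied to a product weight.  At
such coordinates the rectangle contains, up to a factor [9/16], as many pairs
meeting there as pairs missing there.  Since [9/16 * 2/3 > 1/3], a protocol of
cost below [m - 8] cannot be right with probability 2/3 on both kinds of pairs.
*)

Require Import Defs.
From HB Require Import structures.
From mathcomp Require Import all_boot all_order all_algebra all_fingroup.
From mathcomp Require Import Rstruct lra ring zify.
Import Order.TTheory GRing.Theory Num.Theory.
Local Open Scope ring_scope.
Set Implicit Arguments. Unset Strict Implicit. Unset Printing Implicit Defensive.

(** * Biased coordinates *)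

Definition below (I : finType) (A : {set {set I}}) (D : {set I}) : {set {set I}} :=
  [set x in A | x \subset D].

Definition with_elt (I : finType) (i : I) (S : {set {set I}}) : {set {set I}} :=
  [set x in S | i \in x].

Definition without_elt (I : finType) (i : I) (S : {set {set I}}) : {set {set I}} :=
  [set x in S | i \notin x].

(** Only a shortage of sets containing [i] does harm, by making pairs that meet at [i] scarce. The
    ratio 3/4 for each player multiplies to 9/16 for the pair. *)
Definition biased (I : finType) (A : {set {set I}}) (D : {set I}) : {set I} :=
  [set i in D | (4 * #|with_elt i (below A D)|
                  < 3 * #|without_elt i (below A D)|)%N].

Lemma card_with_without (I : finType) (i : I) (S : {set {set I}}) :
  (#|with_elt i S| + #|without_elt i S| = #|S|)%N.
Proof.
rewrite -(cardsID [set x : {set I} | i \in x] S); congr (_ + _)%N.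
  by apply: eq_card => x; rewrite !inE.
by apply: eq_card => x; rewrite !inE andbC.
Qed.

Section BiasedCoordinates.
Variable F : realFieldType.

Lemma bernoulli (x : F) (n : nat) : 0 <= x -> 1 + n%:R * x <= (1 + x) ^+ n.
Proof.
move=> x0; elim: n => [|n IH]; first by rewrite mul0r addr0 expr0.
rewrite exprS; apply: le_trans (ler_wpM2l _ IH); last by rewrite addr_ge0.
rewrite -natr1; have := mulr_ge0 (ler0n F n) (mulr_ge0 x0 x0); nra.
Qed.

Lemma sum_tilted_weight (I : finType) (B D : {set I}) : B \subset D ->
  \sum_(x : {set I} | x \subset D) \prod_(i in B) (if i \in x then 6 / 7 else 8 / 7 : F)
  = 2 ^+ #|D|.
Proof.
move=> sBD.
(* [f i] is the factor for containing [i], [g i] for omitting it. As [f] vanishes off [D], expanding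
   the product leaves only the subsets of [D]. *)
pose f i : F := if i \in D then (if i \in B then 6 / 7 else 1) else 0.
pose g i : F := if i \in B then 8 / 7 else 1.
have <- : \prod_i (f i + g i) = 2 ^+ #|D|.
  rewrite (bigID (mem D)) /= [X in _ * X]big1 ?mulr1 => [|i iD]; last first.
    rewrite /f /g (negPf iD) (negPf (contra (subsetP sBD i) iD)); lra.
  rewrite (eq_bigr (fun=> 2)) ?prodr_const // => i iD.
  rewrite /f /g iD; case: ifP => _; lra.
rewrite bigA_distr [RHS](bigID (fun x : {set I} => x \subset D)) /=.
rewrite [X in _ + X]big1 ?addr0 => [|x /subsetPn[i ix iD]]; last first.
  by rewrite (bigD1 i) //= ix /f (negPf iD) mul0r.
apply: eq_bigr => x sxD; rewrite [RHS](bigID (mem B)) /=.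
rewrite [X in _ = _ * X]big1 ?mulr1 => [|i iB]; last first.
  by case: ifP => [ix|_]; rewrite /f /g (negPf iB) // (subsetP sxD _ ix).
by apply: eq_bigr => i iB; rewrite /f /g iB (subsetP sBD _ iB).
Qed.

(** At p : q = 3 : 4 the seventh power amounts to (6/7)^3 (8/7)^4 > 15/14 per set; each further unit
    of 3q - 4p gains a factor 4/3. *)
Lemma tilted_weight_gain (p q : nat) : (4 * p <= 3 * q)%N ->
  (15 / 14 : F) ^+ (p + q) <= ((6 / 7) ^+ p * (8 / 7) ^+ q) ^+ 7.
Proof.
move=> hpq; set k : F := (8 / 7) ^+ 4 * (6 / 7) ^+ 3.
apply: (@le_trans _ _ (k ^+ (p + q))).
  by apply: lerXn2r; rewrite ?nnegrE /k; lra.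
have -> : ((6 / 7 : F) ^+ p * (8 / 7) ^+ q) ^+ 7 = k ^+ (p + q) * (4 / 3) ^+ (3 * q - 4 * p).
  have e4 : (4 / 3 : F) = (8 / 7) / (6 / 7) by lra.
  have u6 : (6 / 7 : F) \is a GRing.unit by rewrite unitfE gt_eqF //; lra.
  rewrite e4 /k; move: (8 / 7 : F) (6 / 7 : F) u6 => t s us.
  rewrite expr_div_n [LHS]exprMn [(t ^+ 4 * _) ^+ _]exprMn -!exprM.
  have -> : (p * 7 = 3 * (p + q) - (3 * q - 4 * p))%N by lia.
  have -> : (q * 7 = 4 * (p + q) + (3 * q - 4 * p))%N by lia.
  rewrite exprD exprB //; last by lia.
  rewrite !(mulnC _ (p + q)%N) !exprM.
  move: (s ^+ _) (s ^+ (p + q)) (t ^+ _) (t ^+ (p + q)) => a b c d.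
  ring.
by apply: ler_peMr; [apply: exprn_ge0 | apply: exprn_ege1]; rewrite /k; lra.
Qed.

(* AM-GM over the family, applied to the product weight that favours sets
   avoiding [B]: its mean over the whole cube is 1, while its geometric mean
   over the family is exponentially large in the size of [B]. *)
Lemma biased_family_bound (I : finType) (S : {set {set I}}) (B D : {set I}) :
  {in S, forall x : {set I}, x \subset D} -> B \subset D ->
  {in B, forall i, (4 * #|with_elt i S| <= 3 * #|without_elt i S|)%N} ->
  #|S|%:R ^+ 7 * (15 / 14 : F) ^+ #|B| <= (2 ^+ #|D|) ^+ 7.
Proof.
have k0 : 0 <= 15 / 14 :> F by lra.
move=> sSD sBD hB; have [->|S0] := posnP #|S|.
  by rewrite mulr0n expr0n /= mul0r !exprn_ge0 // ler0n.
pose g (x : {set I}) : F := \prod_(i in B) (if i \in x then 6 / 7 else 8 / 7).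
have g0 x : 0 <= g x by apply: prodr_ge0 => i _; case: ifP => _; lra.
have N0 : 0 < #|S|%:R :> F by rewrite ltr0n.
have sumS : \sum_(x in S) g x <= 2 ^+ #|D|.
  rewrite -(sum_tilted_weight sBD) [leRHS](bigID (mem S)) /=.
  rewrite [X in _ <= X + _](eq_bigl (mem S)) => [|x]; last first.
    by case xS: (x \in S); rewrite ?andbF // sSD.
  by rewrite lerDl; apply: sumr_ge0 => x _; exact: g0.
have prodS : (15 / 14) ^+ (#|B| * #|S|) <= (\prod_(x in S) g x) ^+ 7.
  rewrite exchange_big /= -prodrXl mulnC exprM -prodr_const.
  apply: ler_prod => i iB; rewrite exprn_ge0 /=; last by lra.
  rewrite (bigID (fun x : {set I} => i \in x)) /=.
  rewrite (eq_bigr (fun=> 6 / 7)) => [|x /andP[_ ->]//].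
  rewrite [X in _ <= (_ * X) ^+ _](eq_bigr (fun=> 8 / 7)) => [|x /andP[_ /negPf->]//].
  rewrite -(card_with_without i S); have := tilted_weight_gain (hB _ iB).
  have card_prod (P : pred {set I}) (c : F) : \prod_(x in S | P x) c = c ^+ #|[set x in S | P x]|.
    by rewrite -prodr_const; apply: eq_bigl => x; rewrite inE.
  by rewrite !card_prod.
(* An ordered field may lack roots, so the geometric mean is handled through [#|S|]-th powers. *)
have root_le (a b : F) : 0 <= a -> 0 <= b -> a ^+ #|S| <= b ^+ #|S| -> a <= b.
  by move=> a0 b0; rewrite ler_pXn2r.
apply: root_le.
- by apply: mulr_ge0; apply: exprn_ge0; [exact: ler0n | exact: k0].
- by do 2! apply: exprn_ge0; exact: ler0n.
have [agm _] := leif_AGM (A := mem S) (fun x _ => g0 x).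
have {}agm : #|S|%:R ^+ #|S| * \prod_(x in S) g x <= (2 ^+ #|D|) ^+ #|S|.
  rewrite -ler_pdivlMl ?exprn_gt0 // mulrC -expr_div_n; apply: le_trans agm _.
  by rewrite lerXn2r ?nnegrE ?divr_ge0 ?exprn_ge0 ?sumr_ge0 ?ler_pM2r ?invr_gt0.
apply: (@le_trans _ _ ((#|S|%:R ^+ #|S| * \prod_(x in S) g x) ^+ 7)).
  have -> : (#|S|%:R ^+ 7 * (15 / 14 : F) ^+ #|B|) ^+ #|S|
      = (#|S|%:R ^+ #|S|) ^+ 7 * (15 / 14) ^+ (#|B| * #|S|).
    by rewrite exprMn exprAC -(exprM (15 / 14)).
  rewrite [leRHS]exprMn.
  by rewrite ler_wpM2l ?exprn_ge0.
rewrite [leRHS]exprAC lerXn2r ?nnegrE ?mulr_ge0 ?exprn_ge0 //.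
by rewrite prodr_ge0.
Qed.

End BiasedCoordinates.

Section RectangleBound.
Variables (F : realFieldType) (I : finType).
Implicit Types (A B : {set {set I}}) (D : {set I}).

Lemma card_setType : #|{: {set I}}| = (2 ^ #|I|)%N.
Proof. by rewrite -[in RHS]cardsT -card_powerset powersetT cardsT. Qed.

Lemma card_below_le A D : (#|below A D| <= 2 ^ #|D|)%N.
Proof.
rewrite -card_powerset; apply/subset_leq_card/subsetP => x.
by rewrite !inE => /andP[].
Qed.

(** The constant is 98 = 14 * 7: (15/14)^14 is at least 2 by Bernoulli, and the bound on the family
    is stated for seventh powers. *)
Lemma many_biased_few_below A D (m : nat) : (98 * m <= #|biased A D|)%N ->
  #|below A D|%:R * 2 ^+ m <= 2 ^+ #|D| :> F.
Proof.
move=> hm; set N := #|below A D|%:R.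
have k1 : 1 <= 15 / 14 :> F by lra.
have k14 : 2 <= (15 / 14 : F) ^+ 14.
  have e0 : 0 <= 14^-1 :> F by lra.
  have e1 : 1 + 14^-1 = 15 / 14 :> F by lra.
  have e2 : 1 + 14%:R * 14^-1 = 2 :> F by lra.
  by rewrite -e1 -[leLHS]e2; exact: bernoulli.
have bound : N ^+ 7 * (15 / 14 : F) ^+ #|biased A D| <= (2 ^+ #|D|) ^+ 7.
  apply: biased_family_bound => [x|| i]; rewrite ?inE; first by case/andP.
    by apply/subsetP => i; rewrite inE => /andP[].
  by case/andP=> _ /ltnW.
have k98 : (2 ^+ m) ^+ 7 <= (15 / 14 : F) ^+ #|biased A D|.
  apply: (@le_trans _ _ ((15 / 14 : F) ^+ (98 * m))); last exact: ler_weXn2l.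
  have -> : (98 * m = 14 * (m * 7))%N by lia.
  rewrite -exprM [leRHS]exprM; apply: lerXn2r => //; rewrite nnegrE //.
  by apply: le_trans k14.
have N0 : 0 <= N by exact: ler0n.
rewrite -(@ler_pXn2r _ 7) ?nnegrE ?mulr_ge0 ?exprn_ge0 // exprMn.
by apply: le_trans bound; apply: ler_wpM2l; rewrite ?exprn_ge0.
Qed.

(** For each [D], either at most 98m elements are biased, or [A] is so thin below [D] that all of
    them together cost at most [#|I|] 2^[#|I|] / 2^m. There are 2^[#|I|] sets [D]. *)
Lemma sum_biased A B (m : nat) :
  \sum_D \sum_(i in biased A D) (#|below A D| * #|below B (~: D)|)%:R
  <= (98 * m)%:R * (\sum_D (#|below A D| * #|below B (~: D)|)%:R)
     + #|I|%:R * 4 ^+ #|I| / 2 ^+ m :> F.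
Proof.
have -> : #|I|%:R * 4 ^+ #|I| / 2 ^+ m
    = \sum_(D : {set I}) #|I|%:R * 2 ^+ #|I| / 2 ^+ m :> F.
  rewrite sumr_const -[RHS]mulr_natr card_setType natrX.
  have -> : 4 = 2 * 2 :> F by ring.
  by rewrite exprMn; ring.
rewrite mulr_sumr -big_split; apply: ler_sum => D _ /=.
rewrite sumr_const -[leLHS]mulr_natl; set ab := (_ * _)%:R.
have ab0 : 0 <= ab by exact: ler0n.
have m0 : 0 < 2 ^+ m :> F by rewrite exprn_gt0.
have K0 : 0 <= #|I|%:R :> F by exact: ler0n.
case: (leqP #|biased A D| (98 * m)) => [le|/ltnW /many_biased_few_below lt].
  rewrite ler_wpDr ?ler_wpM2r ?ler_nat //.
  by rewrite divr_ge0 ?mulr_ge0 ?exprn_ge0 // ltW.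
rewrite ler_wpDl ?mulr_ge0 // -mulrA ler_pM ?ler_nat ?max_card //.
rewrite ler_pdivlMr // /ab natrM mulrAC -(cardC (mem D)) exprD.
rewrite ler_pM ?mulr_ge0 ?(ltW m0) //.
rewrite -natrX ler_nat (leq_trans (card_below_le _ _)) // leq_pexp2l //.
by rewrite subset_leq_card //; apply/subsetP => i; rewrite !inE.
Qed.

End RectangleBound.

(** * Corruption of rectangles *)

Section Corruption.
Variables (F : realFieldType) (I : finType).
Implicit Types (A B : {set {set I}}) (D x y : {set I}).

(* Up to normalisation, three joint laws of a pair of subsets.  A uniform set
   [D] allots every element to one of the two players, each of whom keeps it
   with probability 1/2: this is [split_weight].  In the other two laws one
   uniform element [i] is allotted to both players, and is given to neither
   of them ([miss_weight]) or to both ([meet_weight]). *)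
Definition split_weight x y : F :=
  \sum_(D : {set I}) ((x \subset D) && (y \subset ~: D))%:R.

Definition miss_weight x y : F :=
  \sum_(t : I * {set I} | t.1 \notin t.2)
    (((x \subset t.1 |: t.2) && (t.1 \notin x))
     && ((y \subset ~: t.2) && (t.1 \notin y)))%:R.

Definition meet_weight x y : F :=
  \sum_(t : I * {set I} | t.1 \notin t.2)
    (((x \subset t.1 |: t.2) && (t.1 \in x))
     && ((y \subset ~: t.2) && (t.1 \in y)))%:R.

Lemma sum_rectangle (T U V : finType) (P : pred T) (a : T -> pred U) (b : T -> pred V)
    (A : {set U}) (B : {set V}) :
  \sum_(x in A) \sum_(y in B) \sum_(t | P t) (a t x && b t y)%:R
  = \sum_(t | P t) (#|[set x in A | a t x]| * #|[set y in B | b t y]|)%:R :> F.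
Proof.
under eq_bigr do rewrite exchange_big.
rewrite exchange_big; apply: eq_bigr => t _ /=.
have card_sum (W : finType) (S : {set W}) (c : pred W) :
    #|[set x in S | c x]|%:R = \sum_(x in S) (c x)%:R :> F.
  rewrite -sum1_card natr_sum big_mkcond [RHS]big_mkcond /=.
  by apply: eq_bigr => x _; rewrite inE; case: (x \in S); case: (c x).
rewrite natrM !card_sum mulr_suml; apply: eq_bigr => x _.
by rewrite mulr_sumr; apply: eq_bigr => y _; rewrite -natrM mulnb.
Qed.

Lemma sum_split_weight A B :
  \sum_(x in A) \sum_(y in B) split_weight x y
  = \sum_D (#|below A D| * #|below B (~: D)|)%:R.
Proof. by rewrite sum_rectangle. Qed.

Lemma sum_miss_weight A B :
  \sum_(x in A) \sum_(y in B) miss_weight x y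
  = \sum_(t : I * {set I} | t.1 \notin t.2)
      (#|without_elt t.1 (below A (t.1 |: t.2))|
       * #|without_elt t.1 (below B (~: t.2))|)%:R.
Proof.
rewrite sum_rectangle; apply: eq_bigr => t _; congr (_ * _)%:R;
  by apply: eq_card => x; rewrite !inE andbA.
Qed.

Lemma sum_meet_weight A B :
  \sum_(x in A) \sum_(y in B) meet_weight x y
  = \sum_(t : I * {set I} | t.1 \notin t.2)
      (#|with_elt t.1 (below A (t.1 |: t.2))|
       * #|with_elt t.1 (below B (~: t.2))|)%:R.
Proof.
rewrite sum_rectangle; apply: eq_bigr => t _; congr (_ * _)%:R;
  by apply: eq_card => x; rewrite !inE andbA.
Qed.

Lemma without_elt_below A D (i : I) : without_elt i (below A D) = below A (D :\ i).
Proof. by apply/setP => x; rewrite !inE subsetD1 andbA. Qed.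

(** A pair that misses at [i] also respects the split allotting [i] to Alice alone, so it is charged
    to the allotment [t.1 |: t.2], of which [i] is a biased element. *)
Lemma sum_miss_biased_left A B :
  \sum_(t : I * {set I} | t.1 \notin t.2)
     (t.1 \in biased A (t.1 |: t.2))%:R
     * (#|without_elt t.1 (below A (t.1 |: t.2))|
        * #|without_elt t.1 (below B (~: t.2))|)%:R
  <= \sum_D \sum_(i in biased A D) (#|below A D| * #|below B (~: D)|)%:R :> F.
Proof.
rewrite (exchange_big_dep xpredT) //= -(pair_big_dep xpredT (fun i D => i \notin D)
  (fun i D => (i \in biased A (i |: D))%:R
     * (#|without_elt i (below A (i |: D))|
        * #|without_elt i (below B (~: D))|)%:R)) /=.
apply: ler_sum => i _.
rewrite (reindex_onto (fun D => D :\ i) (fun D => i |: D)) /= => [|D iD]; last first.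
  by rewrite setU1K.
rewrite big_mkcond [leRHS]big_mkcond; apply: ler_sum => D _ /=.
case: ifP => [/andP[_ /eqP eD]|_]; last by case: ifP.
rewrite eD; case: ifP => _; rewrite ?mul0r // mul1r ler_nat leq_mul //.
  by rewrite without_elt_below subset_leq_card //; apply/subsetP => x;
    rewrite !inE subsetD1 => /andP[-> /andP[]].
by rewrite without_elt_below setDE -setCU setUC eD.
Qed.

(** Symmetric: [i] is now allotted to Bob alone, whose share is the complement of [t.2]. *)
Lemma sum_miss_biased_right A B :
  \sum_(t : I * {set I} | t.1 \notin t.2)
     (t.1 \in biased B (~: t.2))%:R
     * (#|without_elt t.1 (below A (t.1 |: t.2))|
        * #|without_elt t.1 (below B (~: t.2))|)%:R
  <= \sum_D \sum_(i in biased B D) (#|below B D| * #|below A (~: D)|)%:R :> F.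
Proof.
rewrite (reindex_inj (@setC_inj I)) /= (exchange_big_dep xpredT) //=.
rewrite -(pair_big_dep xpredT (fun i D => i \notin D)
  (fun i D => (i \in biased B (~: D))%:R
     * (#|without_elt i (below A (i |: D))|
        * #|without_elt i (below B (~: D))|)%:R)) /=.
apply: ler_sum => i _.
rewrite big_mkcond [leRHS]big_mkcond; apply: ler_sum => D _ /=.
case: ifP => [iD|_]; last by case: ifP.
case: ifP => _; rewrite ?mul0r // mul1r ler_nat mulnC leq_mul //.
  by rewrite without_elt_below subset_leq_card //; apply/subsetP => x;
    rewrite !inE subsetD1 => /andP[-> /andP[]].
by rewrite without_elt_below setU1K // setCK.
Qed.

Lemma sum_split_weightC A B :
  \sum_D (#|below B D| * #|below A (~: D)|)%:R
  = \sum_D (#|below A D| * #|below B (~: D)|)%:R :> F.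
Proof.
rewrite (reindex_inj (@setC_inj I)) /=.
by apply: eq_bigr => D _; rewrite setCK mulnC.
Qed.

(** The [split_weight] term pays for the at most 98m biased elements, once for each player. *)
Definition corruption_weight (m : nat) x y : F :=
  9 / 16 * (miss_weight x y - 2 * (98 * m)%:R * split_weight x y) - meet_weight x y.

Lemma rectangle_corruption A B (m : nat) :
  \sum_(x in A) \sum_(y in B) corruption_weight m x y
  <= 9 / 8 * (#|I|%:R * 4 ^+ #|I| / 2 ^+ m).
Proof.
have -> : \sum_(x in A) \sum_(y in B) corruption_weight m x y
  = 9 / 16 * (\sum_(x in A) \sum_(y in B) miss_weight x y
              - 2 * (98 * m)%:R * \sum_(x in A) \sum_(y in B) split_weight x y)
    - \sum_(x in A) \sum_(y in B) meet_weight x y.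
  rewrite [in RHS]mulr_sumr -sumrB mulr_sumr -sumrB; apply: eq_bigr => x _.
  by rewrite [in RHS]mulr_sumr -sumrB mulr_sumr -sumrB.
rewrite sum_miss_weight sum_split_weight sum_meet_weight.
have left := le_trans (sum_miss_biased_left A B) (sum_biased F A B m).
have right := le_trans (sum_miss_biased_right A B) (sum_biased F B A m).
rewrite sum_split_weightC in right.
set V := (X in X <= _) in left; set W := (X in X <= _) in right.
set Z := \sum_D _ in left right *; set E := _ / _ in left right *.
set X := \sum_(t | _) _; set U := \sum_(t | _) _.
(* This holds term by term: if [i] is biased for a player, the left side is at most 0; otherwise 3q
   <= 4p and 3s <= 4r multiply to 9qs <= 16pr. *)
suff : 9 / 16 * (X - V - W) <= U.
  move: left right; move: X V W U Z E ((98 * m)%:R : F) => X V W U Z E M l r h.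
  lra.
rewrite /X /V /W /U -!sumrB mulr_sumr; apply: ler_sum => -[i D] /= iD.
rewrite !inE eqxx /= iD.
set p := #|with_elt _ _|; set q := #|without_elt _ _|.
set r := #|with_elt _ (below B _)|; set s := #|without_elt _ (below B _)|.
rewrite !natrM.
have qs0 : 0 <= q%:R * s%:R :> F by exact: mulr_ge0.
have pr0 : 0 <= p%:R * r%:R :> F by exact: mulr_ge0.
have pqrs : (3 * q <= 4 * p)%N -> (3 * s <= 4 * r)%N ->
    (3 * q%:R) * (3 * s%:R) <= (4 * p%:R) * (4 * r%:R) :> F.
  by move=> hp hr; rewrite ler_pM ?mulr_ge0 // -!natrM ler_nat.
move: pqrs qs0 pr0; case: ltnP => hp; case: ltnP => hr /= pqrs qs0 pr0; last first.
  by have := pqrs isT isT; lra.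
all: clear -qs0 pr0; move: qs0 pr0; set qs := _ * s%:R; set pr := p%:R * _ => qs0 pr0; lra.
Qed.

End Corruption.

(** * Total masses of the three laws *)

Section TotalWeights.
Variables (F : realFieldType) (I : finType).

Lemma card_belowT (D : {set I}) : #|below [set: {set I}] D| = (2 ^ #|D|)%N.
Proof.
by rewrite -card_powerset; apply: eq_card => x; rewrite !inE.
Qed.

Lemma card_without_belowT (D : {set I}) (i : I) : i \in D ->
  (#|without_elt i (below [set: {set I}] D)| * 2 = 2 ^ #|D|)%N.
Proof.
by move=> iD; rewrite without_elt_below card_belowT (cardsD1 i D) iD expnS mulnC.
Qed.

Lemma card_with_belowT (D : {set I}) (i : I) : i \in D ->
  (#|with_elt i (below [set: {set I}] D)| * 2 = 2 ^ #|D|)%N.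
Proof.
move=> iD; have := card_without_belowT iD.
have := card_with_without i (below [set: {set I}] D); rewrite card_belowT; lia.
Qed.

Lemma card_avoiding_pairs :
  (#|[set t : I * {set I} | t.1 \notin t.2]| * 2 = #|I| * 2 ^ #|I|)%N.
Proof.
rewrite -[#|[set _ | _]|]sum1_card (eq_bigl (fun t : I * {set I} => xpredT t.1 && (t.1 \notin t.2))) => [|t]; last first.
  by rewrite inE.
rewrite -(pair_big_dep xpredT (fun i (D : {set I}) => i \notin D) (fun _ _ => 1%N)) /=.
rewrite big_distrl -sum_nat_const; apply: eq_bigr => i _ /=.
rewrite -[in RHS]cardsT -(card_without_belowT (in_setT i)) sum1_card.
by congr (_ * _)%N; apply: eq_card => x; rewrite !inE subsetT.
Qed.

Lemma exp2_setC (D : {set I}) : (2 ^ #|D| * 2 ^ #|~: D| = 2 ^ #|I|)%N.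
Proof. by rewrite -expnD cardsC. Qed.

Lemma sum_setT2 (phi : {set I} -> {set I} -> F) :
  \sum_x \sum_y phi x y = \sum_(x in [set: {set I}]) \sum_(y in [set: {set I}]) phi x y.
Proof.
by apply: eq_big => [x|x _]; [|apply: eq_bigl => y]; rewrite inE.
Qed.

Lemma total_split_weight : \sum_(x : {set I}) \sum_y split_weight F x y = 4 ^+ #|I|.
Proof.
rewrite sum_setT2 sum_split_weight.
under eq_bigr do rewrite !card_belowT exp2_setC.
by rewrite sumr_const card_setType -mulrnA -expnMn natrX.
Qed.

Lemma sum_avoiding_pairs (q s : I * {set I} -> nat) :
  (forall t : I * {set I}, t.1 \notin t.2 -> (q t * 2 = 2 ^ #|t.1 |: t.2|)%N) ->
  (forall t : I * {set I}, t.1 \notin t.2 -> (s t * 2 = 2 ^ #|~: t.2|)%N) ->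
  4 * (\sum_(t : I * {set I} | t.1 \notin t.2) (q t * s t)%:R) = #|I|%:R * 4 ^+ #|I| :> F.
Proof.
move=> hq hs; rewrite mulr_sumr (eq_bigr (fun=> (2 * 2 ^ #|I|)%:R)) => [|t ht]; last first.
  rewrite -natrM -(exp2_setC t.2); congr _%:R.
  have := hq t ht; rewrite cardsU1 ht add1n expnS => e.
  have -> : (4 * (q t * s t) = (q t * 2) * (s t * 2))%N by lia.
  by rewrite e (hs t ht) -mulnA.
rewrite (eq_bigl (fun t => t \in [set t : I * {set I} | t.1 \notin t.2])) => [|t]; last by rewrite inE.
rewrite sumr_const -mulrnA mulnAC [(2 * _)%N]mulnC card_avoiding_pairs.
by rewrite -mulnA -expnMn natrM natrX.
Qed.

Lemma total_miss_weight :
  4 * (\sum_(x : {set I}) \sum_y miss_weight F x y) = #|I|%:R * 4 ^+ #|I|.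
Proof.
rewrite sum_setT2 sum_miss_weight; apply: sum_avoiding_pairs => t ht.
  by rewrite card_without_belowT // !inE eqxx.
by rewrite card_without_belowT // inE.
Qed.

Lemma total_meet_weight :
  4 * (\sum_(x : {set I}) \sum_y meet_weight F x y) = #|I|%:R * 4 ^+ #|I|.
Proof.
rewrite sum_setT2 sum_meet_weight; apply: sum_avoiding_pairs => t ht.
  by rewrite card_with_belowT // !inE eqxx.
by rewrite card_with_belowT // inE.
Qed.

End TotalWeights.

(** The inputs reaching a leaf form a rectangle, and there are at most 2^cost leaves. *)
Lemma run_rectangle_bound (F : realFieldType) (X Y O : Type) (T U : finType)
    (f : T -> X) (g : U -> Y) (acc : pred O) (phi : T -> U -> F) (E : F)
    (p : protocol X Y O) (A : {set T}) (B : {set U}) :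
  (forall (A : {set T}) (B : {set U}), \sum_(x in A) \sum_(y in B) phi x y <= E) ->
  \sum_(x in A) \sum_(y in B) phi x y * (acc (run p (f x) (g y)))%:R
  <= 2 ^+ cost p * E.
Proof.
(* The empty rectangle gives [0 <= E], which covers rejecting leaves and lets the cheaper branch be
   bounded by the cost of the other. *)
move=> hE; have E0 : 0 <= E by have := hE set0 set0; rewrite big_set0.
have cost_le (a b : nat) (s t : F) : s <= 2 ^+ a * E -> t <= 2 ^+ b * E ->
    s + t <= 2 ^+ (maxn a b).+1 * E.
  move=> hs ht; rewrite exprS -mulrA mulr2n mulrDl !mul1r.
  apply: lerD; [apply: le_trans hs _ | apply: le_trans ht _].
    by rewrite ler_wpM2r // ler_weXn2l ?ler1n // leq_maxl.
  by rewrite ler_wpM2r // ler_weXn2l ?ler1n // leq_maxr.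
elim: p A B => [o|h p0 IH0 p1 IH1|h p0 IH0 p1 IH1] A B /=.
- rewrite expr0 mul1r; case: (acc o).
    by under eq_bigr do under eq_bigr do rewrite mulr1.
  by rewrite big1 // => x _; rewrite big1 // => y _; rewrite mulr0.
- rewrite (bigID (fun x => h (f x))) /= addrC.
  apply: cost_le; [move: (IH0 [set x in A | ~~ h (f x)] B) | move: (IH1 [set x in A | h (f x)] B)];
    apply: le_trans; rewrite le_eqVlt; apply/orP; left; apply/eqP;
    apply: eq_big => [x|x /andP[_ hx]]; rewrite ?inE //; apply: eq_bigr => y _.
    by rewrite (negPf hx).
  by rewrite hx.
- under eq_bigr do rewrite (bigID (fun y => h (g y))) /=.
  rewrite big_split /= addrC.
  apply: cost_le; [move: (IH0 A [set y in B | ~~ h (g y)]) | move: (IH1 A [set y in B | h (g y)])];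
    apply: le_trans; rewrite le_eqVlt; apply/orP; left; apply/eqP;
    apply: eq_bigr => x _;
    apply: eq_big => [y|y /andP[_ hy]]; rewrite ?inE //.
    by rewrite (negPf hy).
  by rewrite hy.
Qed.

(** * Randomized set disjointness *)

Lemma sum2_lincomb (F : nzRingType) (T U : finType) (u v w : T -> U -> F) (a b c : F) :
  \sum_x \sum_y (a * u x y - b * v x y - c * w x y)
  = a * (\sum_x \sum_y u x y) - b * (\sum_x \sum_y v x y) - c * (\sum_x \sum_y w x y).
Proof.
rewrite !mulr_sumr -!sumrB; apply: eq_bigr => x _.
by rewrite !mulr_sumr -!sumrB.
Qed.

Section WeightSupports.
Variables (F : realFieldType) (I : finType).
Implicit Types x y : {set I}.

Lemma split_weight_ge0 x y : 0 <= split_weight F x y.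
Proof. exact: sumr_ge0. Qed.

Lemma miss_weight_ge0 x y : 0 <= miss_weight F x y.
Proof. exact: sumr_ge0. Qed.

Lemma meet_weight_ge0 x y : 0 <= meet_weight F x y.
Proof. exact: sumr_ge0. Qed.

Lemma miss_weight_meeting x y : ~~ [disjoint x & y] -> miss_weight F x y = 0.
Proof.
case/pred0Pn => j /andP[/= jx jy]; apply: big1 => -[i D] /= _.
case: andP => // -[/andP[sx ix] /andP[sy _]].
move: (subsetP sx _ jx) (subsetP sy _ jy); rewrite !inE.
by case: eqP => [ji|_ /= -> //]; rewrite ji (negPf ix) in jx.
Qed.

Lemma meet_weight_disjoint x y : [disjoint x & y] -> meet_weight F x y = 0.
Proof.
move=> dxy; apply: big1 => -[i D] /= _; case: andP => // -[/andP[_ ix] /andP[_ iy]].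
by rewrite (disjointFr dxy ix) in iy.
Qed.

End WeightSupports.

Lemma success_probE (X Y O : Type) (D : rprotocol X Y O) (ok : X -> Y -> O -> bool) x y :
  success_prob D ok x y = \sum_(e <- D) e.1 * (ok x y (run e.2 x y))%:R.
Proof.
rewrite /success_prob big_mkcond; apply: eq_bigr => e _.
by case: ifP => _; rewrite ?mulr1 ?mulr0.
Qed.

Lemma distribution_mean_le (X Y O : Type) (D : rprotocol X Y O)
    (h : R * protocol X Y O -> R) (M : R) :
  is_distribution D -> (forall e, (cost e.2 <= rcost D)%N -> h e <= M) ->
  \sum_(e <- D) e.1 * h e <= M.
Proof.
case=> D0 D1 hM; rewrite -[leRHS]mul1r -D1 {D1}.
(* The cost bound is frozen as [n] before the induction on [D]. Protocols of probability 0 may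
   exceed it, but add nothing to the mean. *)
move: hM D0 (leqnn (rcost D)); move: {1 3}(rcost D) => n hM.
elim: D => [|e D IH] /=; first by rewrite !big_nil mul0r.
rewrite /rcost !big_cons => /andP[e0 D0]; rewrite mulrDl.
case: (ltP 0 e.1) => [ep|en] /=.
  by rewrite geq_max => /andP[en Dn]; rewrite lerD ?IH // ler_wpM2l ?hM.
have -> : e.1 = 0 by apply: le_anti; rewrite en.
by move=> Dn; rewrite !mul0r !add0r IH.
Qed.

Lemma success_prob_le1 (X Y O : Type) (D : rprotocol X Y O) (ok : X -> Y -> O -> bool) x y :
  is_distribution D -> success_prob D ok x y <= 1.
Proof.
move=> dD; rewrite success_probE.
by apply: distribution_mean_le dD _ => e _; case: (ok _ _ _); rewrite ?lexx ?ler01.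
Qed.

(** Here [a] is the acceptance probability. Correctness keeps 9/16 * 2/3 = 3/8 of the missing mass
    against 1/3 of the meeting mass. Both masses are [#|I|] 4^[#|I|] / 4, so the gain is [#|I|]
    4^[#|I|] / 96; the assumption on [m] lets biased elements use up at most half of it. *)
Lemma corruption_gap (F : realFieldType) (I : finType) (a : {set I} -> {set I} -> F)
    (m : nat) (c : F) :
  (0 < #|I|)%N -> (216 * 98 * m <= #|I|)%N ->
  (forall x y, a x y <= 1) ->
  (forall x y : {set I}, [disjoint x & y] -> 2 / 3 <= a x y) ->
  (forall x y : {set I}, ~~ [disjoint x & y] -> a x y <= 1 / 3) ->
  \sum_x \sum_y corruption_weight F m x y * a x y
    <= c * (9 / 8 * (#|I|%:R * 4 ^+ #|I| / 2 ^+ m)) ->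
  2 ^+ m <= 216 * c.
Proof.
move=> I0 hm a1 hdisj hmeet upper.
have lower : 3 / 8 * (\sum_(x : {set I}) \sum_y miss_weight F x y)
      - 9 / 8 * (98 * m)%:R * (\sum_(x : {set I}) \sum_y split_weight F x y)
      - 1 / 3 * (\sum_(x : {set I}) \sum_y meet_weight F x y)
    <= \sum_x \sum_y corruption_weight F m x y * a x y.
  rewrite -sum2_lincomb; apply: ler_sum => x _; apply: ler_sum => y _.
  have s0 := split_weight_ge0 F x y; have v0 := miss_weight_ge0 F x y.
  have u0 := meet_weight_ge0 F x y.
  have Ma : (98 * m)%:R * split_weight F x y * a x y <= (98 * m)%:R * split_weight F x y.
    by rewrite ler_piMr ?a1 // mulr_ge0 ?ler0n.
  rewrite /corruption_weight; case: (boolP [disjoint x & y]) => dxy.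
    rewrite meet_weight_disjoint //.
    have : miss_weight F x y * (2 / 3) <= miss_weight F x y * a x y.
      by rewrite ler_wpM2l // hdisj.
    clear -Ma; lra.
  rewrite miss_weight_meeting //.
  have : meet_weight F x y * a x y <= meet_weight F x y * (1 / 3).
    by rewrite ler_wpM2l // hmeet.
  clear -Ma; lra.
have := le_trans lower upper; rewrite total_split_weight.
have := total_miss_weight F I; have := total_meet_weight F I.
have P0 : 0 < 4 ^+ #|I| :> F by rewrite exprn_gt0.
have K0 : 0 < #|I|%:R :> F by rewrite ltr0n.
have hK : 216 * 98 * m%:R <= #|I|%:R :> F by rewrite -!natrM ler_nat.
have q0 : 0 < 2 ^+ m :> F by rewrite exprn_gt0.
move: P0 K0 hK q0; rewrite natrM; clear.
set u := \sum_x _; set v := \sum_x _.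
move: u v (#|I|%:R : F) (4 ^+ #|I| : F) (2 ^+ m : F) (m%:R : F) => u v K P q M.
move=> P0 K0 hK q0 hu hv hle.
have KP : 0 < K * P by rewrite mulr_gt0.
have MP : 216 * 98 * M * P <= K * P by rewrite ler_wpM2r // ltW.
have step : K * P / 192 <= c * (9 / 8 * (K * P / q)) by clear -hle hu hv MP; lra.
rewrite -(ler_pM2l KP).
have -> : K * P * (216 * c) = c * (9 / 8 * (K * P / q)) * 192 * q.
  by field; rewrite gt_eqF.
by rewrite ler_wpM2r ?(ltW q0) //; clear -step; lra.
Qed.

Lemma randomized_disjointness (I : finType) (X Y O : Type)
    (f : {set I} -> X) (g : {set I} -> Y) (acc : pred O)
    (D : rprotocol X Y O) (m : nat) :
  is_distribution D ->
  (forall x y : {set I}, [disjoint x & y] ->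
     2 / 3 <= success_prob D (fun _ _ o => acc o) (f x) (g y)) ->
  (forall x y : {set I}, ~~ [disjoint x & y] ->
     success_prob D (fun _ _ o => acc o) (f x) (g y) <= 1 / 3) ->
  (0 < #|I|)%N -> (216 * 98 * m <= #|I|)%N -> (m < rcost D + 8)%N.
Proof.
move=> dD hdisj hmeet I0 hm.
pose a x y := success_prob D (fun _ _ o => acc o) (f x) (g y).
have upper : \sum_x \sum_y corruption_weight R m x y * a x y
    <= 2 ^+ rcost D * (9 / 8 * (#|I|%:R * 4 ^+ #|I| / 2 ^+ m)).
  have -> : \sum_x \sum_y corruption_weight R m x y * a x y
      = \sum_(e <- D) e.1 *
          (\sum_x \sum_y corruption_weight R m x y * (acc (run e.2 (f x) (g y)))%:R).
    under eq_bigr do under eq_bigr do rewrite /a success_probE mulr_sumr.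
    under eq_bigr do rewrite exchange_big.
    rewrite exchange_big; apply: eq_bigr => e _ /=.
    rewrite mulr_sumr; apply: eq_bigr => x _; rewrite mulr_sumr; apply: eq_bigr => y _.
    by rewrite mulrCA.
  apply: distribution_mean_le dD _ => e le_cost; rewrite sum_setT2.
  have := run_rectangle_bound f g acc e.2 [set: {set I}] [set: {set I}]
    (fun A B => rectangle_corruption R A B m).
  move/le_trans; apply; rewrite ler_wpM2r ?ler_weXn2l ?ler1n //.
  by rewrite !mulr_ge0 ?invr_ge0 ?exprn_ge0 // ?ler0n.
have := corruption_gap I0 hm (fun x y => success_prob_le1 _ (f x) (g y) dD) hdisj hmeet upper.
(* The 8 spare bits come from 216 < 2^8. *)
rewrite ltnNge => step; apply/negP => mle.
have : 2 ^+ (rcost D + 8) <= 2 ^+ m :> R by rewrite ler_weXn2l ?ler1n.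
move/le_trans/(_ step); rewrite exprD mulrC -natrX.
by rewrite ler_pM2r ?exprn_gt0 // ler_nat.
Qed.

(** * The market *)

Section RankByScore.
Variables (n : nat) (f : 'I_n -> nat).

(** Ties in the score are broken by index; the market is analysed through strict score inequalities
    only. *)
Let key (x : 'I_n) : nat := (f x * n + x)%N.

Let key_inj : injective key.
Proof.
move=> x y; rewrite /key => e; apply: val_inj.
have n0 : (0 < n)%N by apply: leq_ltn_trans (ltn_ord x).
by have := congr1 (modn^~ n) e; rewrite !modnMDl !modn_small.
Qed.

Definition key_count (x : 'I_n) : nat := #|[set y | (key y < key x)%N]|.

Let key_count_lt x y : (key x < key y)%N -> (key_count x < key_count y)%N.
Proof.
move=> kxy; apply: proper_card; apply/properP; split.
  by apply/subsetP => z; rewrite !inE => /ltn_trans; apply.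
by exists x; rewrite !inE ?ltnn.
Qed.

Let key_count_bound x : (key_count x < n)%N.
Proof.
rewrite -[ltnRHS](card_ord n) -cardsT; apply: proper_card; apply/properP.
by split; [exact: subsetT | exists x; rewrite !inE ?ltnn].
Qed.

Let rank x : 'I_n := Ordinal (key_count_bound x).

Let rank_inj : injective rank.
Proof.
move=> x y /(congr1 val) /= e; apply: key_inj.
by case: (ltngtP (key x) (key y)) => // /key_count_lt; rewrite e ltnn.
Qed.

Definition rank_by_score : {perm 'I_n} := perm rank_inj.

Lemma rank_by_score_lt x y : (f x < f y)%N -> (rank_by_score x < rank_by_score y)%N.
Proof.
move=> fxy; rewrite !permE /=; apply: key_count_lt; rewrite /key.
have := leq_mul2r n (f x).+1 (f y); rewrite fxy orbT mulSn.
have := ltn_ord x; lia.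
Qed.

End RankByScore.

Definition score_profile n (s : 'I_n -> 'I_n -> nat) : profile n :=
  [ffun a => rank_by_score (s a)].

Lemma stable_score n (sW sM : 'I_n -> 'I_n -> nat) (mu : marriage n) (w m : 'I_n) :
  stable (score_profile sW) (score_profile sM) mu ->
  (sW w m < sW w (mu w))%N -> (sM m w < sM m ((mu^-1)%g m))%N -> False.
Proof.
move=> /forallP /(_ w) /forallP /(_ m) /negP nb hw hm; apply: nb.
by rewrite /blocking /prefers !ffunE !rank_by_score_lt.
Qed.

(* Women and men below [k], in [[k, 2k)] and from [2k] on play different
   roles.  The [k] x [k] bits of [x] say which of the second [k] men each of
   the first [k] women likes best, and those of [y] which of the first [k]
   women each of those men likes best.  The agents from [2k] on form a chain
   along which a single divorce propagates. *)
Section Market.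
Variable k : nat.
Implicit Types x y : {set 'I_k * 'I_k}.

Definition entry x (i j : nat) : bool :=
  [exists p in x, (p.1 == i :> nat) && (k + p.2 == j)%N].

Lemma entry_bounds x i j : entry x i j -> (i < k)%N && (k <= j < 2 * k)%N.
Proof.
case/existsP => p /and3P[_ /eqP <- /eqP <-].
by have := ltn_ord p.1; have := ltn_ord p.2; lia.
Qed.

Lemma entry_disjoint x y i j : [disjoint x & y] -> entry x i j -> entry y i j -> False.
Proof.
move=> dxy /existsP[p /and3P[px /eqP pi /eqP pj]] /existsP[q /and3P[qy /eqP qi /eqP qj]].
have pq : p = q.
  case: p q {px qy} pi pj qi qj => p1 p2 [q1 q2] /= e1 e2 e3 e4.
  by congr (_, _); apply: val_inj; move: e1 e2 e3 e4 => /=; lia.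
by rewrite -pq (disjointFr dxy px) in qy.
Qed.

Lemma entry_meet x y : ~~ [disjoint x & y] -> exists i j, entry x i j /\ entry y i j.
Proof.
case/pred0Pn => p /andP[/= px py]; exists p.1, (k + p.2)%N.
by split; apply/existsP; exists p; rewrite ?px ?py !eqxx.
Qed.

(** The reference matching is the identity. Along a chain link the woman ranks the man just after
    her own partner, while the man ranks her above his: they block exactly when she has lost her
    partner and he is not with an equally good woman. *)
Definition woman_score x (w m : nat) : nat :=
  if entry x w m then 0%N
  else if m == w then 1%N
  else if ((k <= w < 2 * k) && (m == 2 * k) || (2 * k <= w) && (m == w.+1))%N then 2%N
  else 3%N.

Definition man_score y (m w : nat) : nat :=
  if [|| entry y w m, (k <= w < 2 * k) && (m == 2 * k) | (2 * k <= w) && (m == w.+1)]%N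
  then 0%N
  else if w == m then 1%N
  else 2%N.

Variable n : nat.

Definition women_of x : profile n := score_profile (fun w m : 'I_n => woman_score x w m).
Definition men_of y : profile n := score_profile (fun m w : 'I_n => man_score y m w).

Lemma entryF x i j : (k <= i)%N || (j < k)%N || (2 * k <= j)%N -> entry x i j = false.
Proof. by apply: contraTF => /entry_bounds; lia. Qed.

Lemma stable_market x y (mu : marriage n) (w w' : 'I_n) :
  stable (women_of x) (men_of y) mu ->
  (woman_score x w (mu w') < woman_score x w (mu w))%N ->
  (man_score y (mu w') w' <= man_score y (mu w') w)%N.
Proof.
move=> st hw; rewrite leqNgt; apply/negP => hm.
by apply: (stable_score (m := mu w') st hw); rewrite permK.
Qed.

Lemma spouse_exists (mu : marriage n) (m : 'I_n) : exists w, mu w = m.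
Proof. by exists ((mu^-1)%g m); rewrite permKV. Qed.

(** Follow a divorce backwards. If man [w] left woman [w], his wife [w'] is linked to him: either
    [w - 1], excluded by induction, or a middle woman with [w] = 2k. Her own man [w'] then has a
    wife [z] whom Bob's set makes him prefer. *)
Lemma disjoint_chain_fixed x y (mu : marriage n) : [disjoint x & y] ->
  stable (women_of x) (men_of y) mu -> forall w : 'I_n, (2 * k <= w)%N -> mu w = w.
Proof.
move=> dxy st w; move: {2}(w : nat) (erefl (w : nat)) => b.
elim/ltn_ind: b w => b IH w wb kw; apply/eqP; apply: contraT => nw.
have {}nw : (mu w != w :> nat) by [].
have [w' ew'] := spouse_exists mu w.
have nw' : (w' != w :> nat).
  by apply: contraNneq nw => e; rewrite -{1}(val_inj e) ew'.
have sw : (woman_score x w w < woman_score x w (mu w))%N.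
  by rewrite /woman_score !entryF ?eqxx ?(negPf nw); do ?case: ifP; lia.
have := stable_market st (w := w) (w' := w'); rewrite ew' => /(_ sw).
rewrite /man_score !entryF ?eqxx ?(negPf nw') /=; try lia.
case: ifP => [lk _|_]; last by case: ifP; lia.
have [w2k|] := boolP (2 * k <= w')%N.
  have := IH w' _ w' erefl w2k; rewrite ew' => e.
  by have : (w = w' :> nat) by [rewrite e //; lia]; lia.
move=> w2k; have {lk} [kw' w2] : (k <= w')%N /\ (w = 2 * k :> nat)%N by lia.
have [z ez] := spouse_exists mu w'.
have nz : (z != w' :> nat).
  by apply: contraNneq nw' => e; rewrite -[X in X == _]/(val w') -ez (val_inj e) ew'.
have sw' : (woman_score x w' w' < woman_score x w' (mu w'))%N.
  by rewrite /woman_score ew' !entryF ?eqxx; do ?case: ifP; lia.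
have := stable_market st (w := w') (w' := z); rewrite ez => /(_ sw').
rewrite /man_score [entry y w' w']entryF ?eqxx ?(negPf nz) /=; last by lia.
case: ifP => [lk _|_]; last by case: ifP; lia.
have {lk} yz : entry y z w' by move: lk; case: (entry y z w') => //=; lia.
have zk : (z < k)%N by have := entry_bounds yz; lia.
(* By disjointness [z] does not favour [w'], so she would rather have man [z]. He likes woman [z]
   best, and the two block. *)
have xz : entry x z w' = false by case E: entry => //; case: (entry_disjoint dxy E yz).
have [v ev] := spouse_exists mu z.
have nv : (v != z :> nat).
  by apply: contraNneq nz => e; rewrite -[X in X == _]/(val z) -ev (val_inj e) ez.
have sz : (woman_score x z z < woman_score x z (mu z))%N.
  by rewrite /woman_score ez xz entryF ?eqxx; do ?case: ifP; lia.
have := stable_market st (w := z) (w' := v); rewrite ev => /(_ sz).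
rewrite /man_score !entryF ?eqxx ?(negPf nv) /=; try lia.
by do ?case: ifP; lia.
Qed.

(** By induction along the chain: a displaced woman [w - 1] would block with man [w] if he kept his
    reference wife. The start [w] = 2k uses the common element. *)
Lemma meeting_chain_moved x y (mu : marriage n) : (2 * k <= n)%N -> ~~ [disjoint x & y] ->
  stable (women_of x) (men_of y) mu -> forall w : 'I_n, (2 * k <= w)%N -> mu w <> w.
Proof.
move=> kn mxy st w; move: {2}(w : nat) (erefl (w : nat)) => b.
elim/ltn_ind: b w => b IH w wb kw ew.
have muK (u : 'I_n) : (mu u = w :> nat) -> (u = w :> nat).
  by move=> e; have /perm_inj-> : mu u = mu w by rewrite ew; apply: val_inj.
have [w2|w2] := eqVneq (w : nat) (2 * k)%N; last first.
  have hw1 : (w.-1 < n)%N by apply: leq_ltn_trans (ltn_ord w); exact: leq_pred.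
  pose u := Ordinal hw1; have eu : (u : nat) = w.-1 by [].
  have nu : mu u <> u by apply: (IH w.-1) => //; lia.
  have nuw : (mu u != w :> nat) by apply/eqP => /muK; lia.
  have {}nu : (mu u != u :> nat) by apply/eqP => e; apply: nu; apply: val_inj.
  have su : (woman_score x u (mu w) < woman_score x u (mu u))%N.
    rewrite ew /woman_score !entryF ?(negPf nu); try lia.
    by do ?case: ifP; lia.
  have := stable_market st su; rewrite ew /man_score !entryF ?eqxx; try lia.
  by do ?case: ifP; lia.
(* If man 2k kept his wife, any displaced middle woman would block with him. *)
have fixc (c : 'I_n) : (k <= c < 2 * k)%N -> mu c = c.
  move=> hc; apply/eqP; apply: contraT => nc.
  have {}nc : (mu c != c :> nat) by [].
  have ncw : (mu c != w :> nat) by apply/eqP => /muK; lia.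
  have sc : (woman_score x c (mu w) < woman_score x c (mu c))%N.
    rewrite ew /woman_score !entryF ?(negPf nc); try lia.
    by do ?case: ifP; lia.
  have := stable_market st sc; rewrite ew /man_score !entryF ?eqxx; try lia.
  by do ?case: ifP; lia.
have [i [j [xij yij]]] := entry_meet mxy.
have ij := entry_bounds xij.
have hi : (i < n)%N by lia. have hj : (j < n)%N by lia.
have ej : mu (Ordinal hj) = Ordinal hj by apply: fixc => /=; lia.
have si : (woman_score x (Ordinal hi) (mu (Ordinal hj))
           < woman_score x (Ordinal hi) (mu (Ordinal hi)))%N.
  (* All middle men are with their reference wives, so woman [i] has none of her favourites and
     blocks with man [j]. *)
  rewrite ej /woman_score /= xij; case: ifP => [/entry_bounds b2|_]; last by do ?case: ifP.
  have /fixc/perm_inj e : (k <= mu (Ordinal hi) < 2 * k)%N by lia.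
  by have := congr1 val e => /= e2; rewrite e2 in b2; lia.
have := stable_market st si; rewrite ej /man_score /= yij /=.
by rewrite !entryF; do ?case: ifP; lia.
Qed.

End Market.

(** * Reduction from disjointness to almost stable marriages *)

Lemma almost_stable_witness (eps : R) n (PW PM : profile n) (mu : marriage n) :
  eps < 1 -> (0 < n)%N -> almost_stable eps PW PM mu ->
  exists2 mu' : marriage n, stable PW PM mu' & (divorce_dist mu mu')%:R <= eps * n%:R.
Proof.
move=> eps1 n0; rewrite /almost_stable.
(* The minimum is either attained or equal to its default [n], which exceeds [eps * n]. *)
have : dist_to_stable PW PM mu = n \/
    exists2 mu' : marriage n, stable PW PM mu' & dist_to_stable PW PM mu = divorce_dist mu mu'.
  rewrite /dist_to_stable.
  elim/big_rec: _ => [|mu' d st IH]; first by left.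
  by rewrite /minn; case: ifP => _; [right; exists mu' | exact: IH].
case=> [-> | [mu' st ->] le]; last by exists mu'.
by rewrite leNgt gtr_pMl ?ltr0n // eps1.
Qed.

(** This statistic of the output decides disjointness, with threshold [eps * n]. *)
Definition chain_fixed (k n : nat) (mu : marriage n) : nat :=
  #|[set w : 'I_n | (2 * k <= w)%N && (mu w == w)]|.

Lemma divorce_dist_bound n (mu mu' : marriage n) :
  (#|[set w : 'I_n | mu w == mu' w]| + divorce_dist mu mu' = n)%N.
Proof. by rewrite /divorce_dist subnKC // -[leqRHS](card_ord n) max_card. Qed.

Lemma chain_fixed_disjoint (k n : nat) (x y : {set 'I_k * 'I_k}) (mu mu' : marriage n) :
  [disjoint x & y] -> stable (women_of n x) (men_of n y) mu' ->
  (n <= chain_fixed k mu + 2 * k + divorce_dist mu mu')%N.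
Proof.
move=> dxy st; rewrite -[leqLHS](divorce_dist_bound mu mu') leq_add2r.
have fixed := disjoint_chain_fixed dxy st.
rewrite -(cardsID [set w : 'I_n | (2 * k <= w)%N]) leq_add //.
  apply/subset_leq_card/subsetP => w; rewrite !inE => /andP[/eqP-> kw].
  by rewrite kw fixed // eqxx.
apply: (@leq_trans #|[set w : 'I_n | (w < 2 * k)%N]|).
  by apply/subset_leq_card/subsetP => w; rewrite !inE -ltnNge => /andP[].
rewrite cardE -(size_map val) -[leqRHS](size_iota 0); apply: uniq_leq_size.
  by rewrite (map_inj_uniq val_inj) enum_uniq.
by move=> i /mapP[w]; rewrite mem_enum inE mem_iota => ? ->.
Qed.

Lemma chain_fixed_meeting (k n : nat) (x y : {set 'I_k * 'I_k}) (mu mu' : marriage n) :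
  (2 * k <= n)%N -> ~~ [disjoint x & y] -> stable (women_of n x) (men_of n y) mu' ->
  (chain_fixed k mu <= divorce_dist mu mu')%N.
Proof.
move=> kn mxy st; rewrite -(leq_add2l #|[set w : 'I_n | mu w == mu' w]|) divorce_dist_bound.
have moved := meeting_chain_moved kn mxy st.
rewrite -cardsUI -[leqRHS](card_ord n).
rewrite [X in (_ + X)%N](_ : _ = 0%N) ?addn0 ?max_card //.
apply/eqP; rewrite cards_eq0; apply/eqP/setP => w; rewrite !inE.
apply/negP => /and3P[/eqP e kw /eqP e2].
by apply: (moved w kw); rewrite -e.
Qed.

Lemma success_prob_mono (X Y O : Type) (D : rprotocol X Y O)
    (ok ok' : X -> Y -> O -> bool) x y :
  is_distribution D -> (forall o, ok x y o -> ok' x y o) ->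
  success_prob D ok x y <= success_prob D ok' x y.
Proof.
case=> D0 _ sub; rewrite !success_probE.
elim: D D0 => [|e D IH] /=; first by rewrite !big_nil.
move=> /andP[e0 /IH le]; rewrite !big_cons lerD // ler_wpM2l // ler_nat.
by case: (ok _ _ _) (sub (run e.2 x y)) => // ->.
Qed.

Lemma success_probC (X Y O : Type) (D : rprotocol X Y O) (ok : X -> Y -> O -> bool) x y :
  is_distribution D ->
  success_prob D ok x y + success_prob D (fun x y o => ~~ ok x y o) x y = 1.
Proof. by case=> _ <-; rewrite [RHS](bigID (fun e => ok x y (run e.2 x y))). Qed.

Lemma almost_stable_rcost (eps : R) (n k m : nat)
    (D : rprotocol (profile n) (profile n) (marriage n)) :
  0 <= eps -> (0 < k)%N -> (2 * k)%:R < (1 - 2 * eps) * n%:R ->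
  is_distribution D ->
  (forall PW PM : profile n,
     2 / 3 <= success_prob D (fun PW PM mu => almost_stable eps PW PM mu) PW PM) ->
  (216 * 98 * m <= k * k)%N -> (m < rcost D + 8)%N.
Proof.
move=> eps0 k0 hk dD ok hm.
have card_kk : #|{: 'I_k * 'I_k}| = (k * k)%N by rewrite card_prod !card_ord.
have n0 : (0 < n)%N.
  by rewrite lt0n; apply: contraTneq hk => ->; rewrite mulr0 -leNgt ler0n.
have n0' : 0 < n%:R :> R by rewrite ltr0n.
have eps1 : eps < 1 by have := ler0n R (2 * k); nra.
have kn : (2 * k <= n)%N by rewrite -(ler_nat R); nra.
(* Disjoint sets force at least n - 2k - eps n fixed chain pairs, which exceeds eps n by the choice
   of [k]; meeting sets allow at most eps n. *)
apply: (@randomized_disjointness ('I_k * 'I_k)%type _ _ _ (@women_of k n) (@men_of k n)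
  (fun mu => eps * n%:R < (chain_fixed k mu)%:R)) => //; last 2 first.
- by rewrite card_kk muln_gt0 k0.
- by rewrite card_kk.
- move=> x y dxy; apply: le_trans (ok (women_of n x) (men_of n y)) _.
  apply: success_prob_mono => // mu /(almost_stable_witness eps1 n0)[mu' st le].
  have := chain_fixed_disjoint mu dxy st.
  rewrite -(ler_nat R) !natrD => h; lra.
- move=> x y mxy.
  have := success_probC (fun _ _ mu => eps * n%:R < (chain_fixed k mu)%:R)
    (women_of n x) (men_of n y) dD.
  have : success_prob D (fun PW PM mu => almost_stable eps PW PM mu) (women_of n x) (men_of n y)
     <= success_prob D (fun _ _ mu => ~~ (eps * n%:R < (chain_fixed k mu)%:R))
          (women_of n x) (men_of n y).
    apply: success_prob_mono => // mu /(almost_stable_witness eps1 n0)[mu' st le].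
    rewrite -leNgt; apply: le_trans le.
    by rewrite ler_nat (chain_fixed_meeting mu kn mxy st).
  have := ok (women_of n x) (men_of n y).
  lra.
Qed.

(* Alice holds the women's profile PW, Bob the men's profile PM.
   Omega(n^2): there are c > 0 and N such that for all n >= N every
   randomized (public-coin, success prob >= 2/3 on every input) protocol, and
   every deterministic protocol, that outputs a (1-eps)-stable perfect marriage
   has cost >= c * n^2. *)
Theorem theorem7 (eps : R) : 0 <= eps -> eps < 1 / 2 ->
  exists c : R, 0 < c /\ exists N : nat, forall n : nat, (N <= n)%N ->
    (forall D : rprotocol (profile n) (profile n) (marriage n),
       is_distribution D ->
       (forall PW PM : profile n,
          2 / 3 <= success_prob D (fun PW PM mu => almost_stable eps PW PM mu) PW PM) ->
       c * (n ^ 2)%:R <= (rcost D)%:R)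
    /\
    (forall p : protocol (profile n) (profile n) (marriage n),
       (forall PW PM : profile n, almost_stable eps PW PM (run p PW PM)) ->
       c * (n ^ 2)%:R <= (cost p)%:R).
Proof.
move=> eps0 eps2; pose th : R := 1 - 2 * eps.
have th0 : 0 < th by rewrite /th; lra.
have rand (n : nat) (D : rprotocol (profile n) (profile n) (marriage n)) :
    3600 <= th * n%:R -> is_distribution D ->
    (forall PW PM : profile n,
       2 / 3 <= success_prob D (fun PW PM mu => almost_stable eps PW PM mu) PW PM) ->
    th ^+ 2 / (36 * 2 * 216 * 98) * (n ^ 2)%:R <= (rcost D)%:R.
  (* With [k] about th n / 3, 2k stays below th n while [k] is at least th n / 6. *)
  move=> hn dD ok; pose k := Num.truncn (th * n%:R / 3).
  have /andP[k_le k_gt] : k%:R <= th * n%:R / 3 < k.+1%:R.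
    by apply: truncn_itv; lra.
  rewrite -(natr1 k) in k_gt.
  have k6 : th * n%:R / 6 <= k%:R by lra.
  pose m := ((k * k) %/ (216 * 98))%N.
  have m_lt : (m < rcost D + 8)%N.
    apply: (almost_stable_rcost (eps := eps) (k := k)) => //.
    - by rewrite -(ltr0n R); lra.
    - by rewrite natrM -/th; lra.
    - by rewrite mulnC; exact: leq_trunc_div.
  have : (k * k < (rcost D + 8) * (216 * 98))%N.
    by apply: leq_trans (leq_mul m_lt (leqnn _)); rewrite ltn_ceil.
  rewrite -(ltr_nat R) !natrM natrD => kk.
  have sq : (th * n%:R / 6) * (th * n%:R / 6) <= k%:R * k%:R by rewrite ler_pM //; lra.
  (* Half of 600^2 exceeds 8 * 216 * 98, so the 8 spare bits cost only the factor 2 in the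
     constant. *)
  have big : 600 * 600 <= (th * n%:R / 6) * (th * n%:R / 6) by rewrite ler_pM //; lra.
  by clear -sq big kk; lra.
exists (th ^+ 2 / (36 * 2 * 216 * 98)); split.
  by rewrite divr_gt0 ?exprn_gt0 //; lra.
exists (Num.truncn (3600 / th)).+1 => n hn.
have hth : 3600 <= th * n%:R.
  rewrite mulrC -ler_pdivrMr //; apply: ltW; apply: lt_le_trans (truncnS_gt _) _.
  by rewrite ler_nat.
split=> [D|p ok]; first exact: rand.
have -> : cost p = rcost [:: (1, p)] by rewrite /rcost big_cons big_nil ltr01 maxn0.
apply: rand => //; first by split; rewrite /= ?ler01 // big_cons big_nil addr0.
move=> PW PM; rewrite /success_prob big_cons big_nil /= ok addr0; lra.
Qed.
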